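(* Let $G$ be a finite group, let $\Gamma_{\mathrm{P}}(G)$ be its power graph, and let $\mathcal{C}\Gamma_{\mathrm{P}}(G)$ be the complement of $\Gamma_{\mathrm{P}}(G)$. Then the subgraph of $\mathcal{C}\Gamma_{\mathrm{P}}(G)$ induced on the set of its non-isolated vertices is connected and has diameter at most $3$; that is, any two non-isolated vertices of $\mathcal{C}\Gamma_{\mathrm{P}}(G)$ are joined by a path of length at most $3$ in $\mathcal{C}\Gamma_{\mathrm{P}}(G)$.
   Context: All graphs are simple and undirected. For a finite group $G$, the power graph $\Gamma_{\mathrm{P}}(G)$ is the graph with vertex-set $G$ in which two distinct elements $x,y\in G$ are adjacent if and only if one is a power of the other (i.e. $x\in\langle y\rangle$ or $y\in\langle x\rangle$). Its complement $\mathcal{C}\Gamma_{\mathrm{P}}(G)$ has vertex-set $G$, and two distinct elements $x,y$ are adjacent in it if and only if they are not adjacent in $\Gamma_{\mathrm{P}}(G)$, i.e. $x\notin\langle y\rangle$ and $y\notin\langle x\rangle$. A vertex is isolated if it has no neighbours. The diameter is the maximum of the distances between two vertices, where distance is the length (number of edges) of a shortest path. If there are no non-isolated vertices, the assertion is regarded as vacuously true. *)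

(* Defs.v *)
From mathcomp Require Import all_boot all_fingroup.

Set Implicit Arguments.
Unset Strict Implicit.
Unset Printing Implicit Defensive.

Record sgraph (T : finType) := SGraph {
  vertices : {set T};
  edge : rel T;
  edge_sym : symmetric edge;
  edge_irr : irreflexive edge;
  edge_vertices : forall x y, edge x y -> x \in vertices
}.

Section Graphs.

Variables (T : finType) (X : sgraph T).

Definition compl_edge : rel T :=
  [rel x y | [&& x \in vertices X, y \in vertices X, x != y & ~~ edge X x y]].

Fact compl_edge_sym : symmetric compl_edge.
Proof. by move=> x y; rewrite /compl_edge /= andbCA (eq_sym x) edge_sym. Qed.

Fact compl_edge_irr : irreflexive compl_edge.
Proof. by move=> x; rewrite /compl_edge /= eqxx !andbF. Qed.

Fact compl_edge_vertices x y : compl_edge x y -> x \in vertices X.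
Proof. by case/andP. Qed.

Definition complement : sgraph T :=
  @SGraph T (vertices X) compl_edge
    compl_edge_sym compl_edge_irr compl_edge_vertices.

Variable W : {set T}.

Definition induced_edge : rel T :=
  [rel x y | [&& x \in W, y \in W & edge X x y]].

Fact induced_edge_sym : symmetric induced_edge.
Proof. by move=> x y; rewrite /induced_edge /= andbCA edge_sym. Qed.

Fact induced_edge_irr : irreflexive induced_edge.
Proof. by move=> x; rewrite /induced_edge /= edge_irr !andbF. Qed.

Fact induced_edge_vertices x y :
  induced_edge x y -> x \in vertices X :&: W.
Proof. by case/and3P=> Wx _ /edge_vertices Xx; rewrite inE Xx. Qed.

Definition induced : sgraph T :=
  @SGraph T (vertices X :&: W) induced_edge
    induced_edge_sym induced_edge_irr induced_edge_vertices.

Definition isolated (x : T) : bool :=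
  (x \in vertices X) && ~~ [exists y, edge X x y].

Definition non_isolated : {set T} := [set x in vertices X | ~~ isolated x].

(* The path visits x :: p and ends at y, so its length is size p. *)
Definition is_path (x y : T) (p : seq T) : bool :=
  [&& x \in vertices X, path (edge X) x p, uniq (x :: p) & last x p == y].

(* The graph with no vertices counts as connected. *)
Definition is_connected : Prop :=
  {in vertices X &, forall x y, exists p, is_path x y p}.

(* Length of a shortest path from x to y. All paths have length < #|T|; the
   value is #|T| when no path exists. *)
Definition distance (x y : T) : nat :=
  find (fun n => [exists p : n.-tuple T, is_path x y p]) (iota 0 #|T|).

(* Meaningful for connected graphs; 0 when there are no vertices. *)
Definition diameter : nat :=
  \max_(x in vertices X) \max_(y in vertices X) distance x y.

End Graphs.

Section PowerGraph.

Variables (gT : finGroupType) (G : {group gT}).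

Definition power_edge : rel gT :=
  [rel x y | [&& x \in G, y \in G, x != y &
                 (x \in <[y]>%g) || (y \in <[x]>%g)]].

Fact power_edge_sym : symmetric power_edge.
Proof. by move=> x y; rewrite /power_edge /= andbCA (eq_sym x) orbC. Qed.

Fact power_edge_irr : irreflexive power_edge.
Proof. by move=> x; rewrite /power_edge /= eqxx !andbF. Qed.

Fact power_edge_vertices x y : power_edge x y -> x \in (G : {set gT}).
Proof. by case/andP. Qed.

Definition power_graph : sgraph gT :=
  @SGraph gT G power_edge
    power_edge_sym power_edge_irr power_edge_vertices.

End PowerGraph.

(* Main.v *)
(* Adjacency in the complement means that <x> and <y> are incomparable; for
   comparable x and y one may assume x in <y> by symmetry. Let x and y
   be non-isolated, with neighbours a and b respectively. Some
   p-constituent of b lies outside <y>, so b may be taken to be a p-element. If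
   neither x-a-y nor x-b-y is a path, then x lies in <b> and a lies in <y>.
   Subgroups of the cyclic p-group <b> form a chain and a is incomparable with
   x, so a is not in <b>; also b is not in <a>, a subgroup of <y>. Hence
   x-a-b-y is a walk. *)
Require Import Defs.
From mathcomp Require Import all_boot all_fingroup.
From mathcomp Require Import all_solvable.

Set Implicit Arguments.
Unset Strict Implicit.
Unset Printing Implicit Defensive.

Import GroupScope.

Section GraphLemmas.

Variables (T : finType) (X : sgraph T).

(** Cutting out loops never lengthens a walk, so later arguments may build walks without checking
    that their vertices are distinct. *)
Lemma is_path_of_walk x y p :
    x \in vertices X -> path (edge X) x p -> last x p = y ->
  exists2 q, is_path X x y q & size q <= size p.
Proof.
move=> Xx + <-; case/shortenP => q Xq Uq sqp; exists q.
  by rewrite /is_path Xx Xq Uq eqxx.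
by apply: uniq_leq_size sqp; case/andP: Uq.
Qed.

Lemma distance_le_size x y p : is_path X x y p -> distance X x y <= size p.
Proof.
move=> xyp; have [_ _ Uxp _] := and4P xyp.
(* Distinct vertices keep [size p] inside the range [iota 0 #|T|] searched by [distance]. *)
have ltpT : size p < #|T|.
  by rewrite (leq_trans _ (max_card (mem (x :: p)))) ?(card_uniqP Uxp).
rewrite leqNgt; apply/negP=> /(before_find 0); rewrite nth_iota // add0n.
by move/negbT/existsP; case; exists (in_tuple p).
Qed.

Lemma edge_non_isolated x y : edge X x y -> x \in non_isolated X.
Proof.
move=> exy; rewrite inE /isolated (edge_vertices exy) negbK.
by apply/existsP; exists y.
Qed.

(** Both ends of an edge are non-isolated, so the restriction loses no edge. *)
Lemma induced_non_isolated_edge :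
  edge (induced X (non_isolated X)) =2 edge X.
Proof.
move=> x y /=; rewrite /induced_edge /=; case exy: (edge X x y); last by rewrite !andbF.
by rewrite (edge_non_isolated exy) (@edge_non_isolated y x) // edge_sym.
Qed.

Lemma vertices_induced_non_isolated :
  vertices (induced X (non_isolated X)) = non_isolated X.
Proof. by apply/setIidPr/subsetP=> x; rewrite inE => /andP[]. Qed.

End GraphLemmas.

Section PowerGraphLemmas.

Variables (gT : finGroupType) (G : {group gT}).
Let C := complement (power_graph G).

(** Incomparability already forces [x != y], since [x] lies in [<[x]>]. *)
Lemma compl_power_edgeE x y :
  edge C x y = [&& x \in G, y \in G, x \notin <[y]> & y \notin <[x]>].
Proof.
rewrite /= /compl_edge /= /power_edge /=.
case: (x \in G) => //; case: (y \in G) => //=.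
by have [->|_] := eqVneq x y; rewrite ?cycle_id //= negb_or.
Qed.

(** In a cyclic group, inclusion of subgroups is divisibility of their orders, and powers of [p]
    form a chain under divisibility. *)
Lemma cycle_p_elt_total (p : nat) (b x y : gT) :
  p.-elt b -> x \in <[b]> -> y \in <[b]> -> (x \in <[y]>) || (y \in <[x]>).
Proof.
move=> pb bx by_.
have ord z : z \in <[b]> -> exists m, (#|<[z]>| = p ^ m)%N.
  by move=> bz; have /p_natP[m oz] := mem_p_elt pb bz; exists m.
have [[m ox] [n oy]] := (ord x bx, ord y by_).
have [sxb syb]: <[x]> \subset <[b]> /\ <[y]> \subset <[b]> by rewrite !cycle_subG.
rewrite -(cycle_subG x) -(cycle_subG y) -(cardSg_cyclic (cycle_cyclic b) sxb syb).
rewrite -(cardSg_cyclic (cycle_cyclic b) syb sxb) ox oy.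
by case/orP: (leq_total m n) => /(dvdn_exp2l p) ->; rewrite ?orbT.
Qed.

Lemma constt_notin_group (H : {group gT}) x :
  x \notin H -> exists p : nat, x.`_p \notin H.
Proof.
(* [x] is the product of its constituents at indices up to [#[x]]; if all of them were in [H], so
   would be [x]. *)
move=> Hx; suff /existsP[p Hp] : [exists p : 'I_#[x].+1, x.`_p \notin H] by exists p.
apply: contraR Hx; rewrite negb_exists => /forallP Hx.
rewrite -(prod_constt x) big_mkord; apply: group_prod => p _.
by have := Hx p; rewrite negbK.
Qed.

Lemma short_walk_of_cycle x y :
    x \in non_isolated C -> y \in non_isolated C -> x \in <[y]> ->
  exists p, [/\ path (edge C) x p, last x p = y & size p <= 3].
Proof.
rewrite !inE /isolated => /andP[-> /negPn/existsP[a xa]].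
case/andP=> -> /negPn/existsP[b0 yb0] xy.
have [b [p pb yb]] : exists b, exists2 p : nat, p.-elt b & edge C y b.
  move: yb0; rewrite compl_power_edgeE => /and4P[Gy Gb0 yb0 /constt_notin_group[p b0y]].
  exists b0.`_p, p; rewrite ?p_elt_constt // compl_power_edgeE Gy groupX //= b0y andbT.
  (* The constituent is a power of [b0], so it generates a subgroup of [<[b0]>], which misses
     [y]. *)
  by apply: contra yb0; apply/subsetP; rewrite cycle_subG mem_cycle.
have [ay|nay] := boolP (edge C a y).
  by exists [:: a; y]; split=> //; apply/and3P.
have [xb|nxb] := boolP (edge C x b).
  by exists [:: b; y]; split=> //; apply/and3P; rewrite (edge_sym C b).
suff ab : edge C a b.
  by exists [:: a; b; y]; split=> //; apply/and4P; rewrite (edge_sym C b).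
move: xa yb nay nxb; rewrite !compl_power_edgeE.
case/and4P=> -> -> nxa nax /and4P[-> -> nyb nby] /=.
have trans u v w : u \in <[v]> -> v \in <[w]> -> u \in <[w]>.
  by move=> uv vw; apply: subsetP uv; rewrite cycle_subG.
(* As [x] is in [<[y]>], the next two facts leave only [a \in <[y]>] and [x \in <[b]>] as reasons
   for the missing edges. *)
have nya : y \notin <[a]> by apply: contra nxa; apply: trans.
have nbx : b \notin <[x]> by apply: contra nby => /trans; apply.
rewrite nya nbx !andbT !negbK => ay xb.
apply/andP; split; last by apply: contra nby => /trans; apply.
apply/negP=> ab; case/orP: (cycle_p_elt_total pb xb ab); exact/negP.
Qed.

Lemma non_isolated_short_walk x y :
    x \in non_isolated C -> y \in non_isolated C ->
  exists p, [/\ path (edge C) x p, last x p = y & size p <= 3].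
Proof.
move=> Cx Cy; have [xy|nxy] := boolP (x \in <[y]>).
  exact: short_walk_of_cycle.
have [yx|nyx] := boolP (y \in <[x]>).
  have [p [Cp <- szp]] := short_walk_of_cycle Cy Cx yx.
  (* The walk from [y] is reversed; [belast] drops its end [x], now the implicit start. *)
  exists (rev (belast y p)); split; last by rewrite size_rev size_belast.
    by rewrite rev_path (eq_path (e' := edge C)) // => u v; rewrite edge_sym.
  by case: p {Cp szp} => //= z p; rewrite rev_cons last_rcons.
exists [:: y]; split=> //=; rewrite andbT.
move: Cx Cy; rewrite !inE => /andP[Gx _] /andP[Gy _].
by apply: etrans (compl_power_edgeE x y) _; apply/and4P.
Qed.

End PowerGraphLemmas.

Theorem corollary2 (gT : finGroupType) (G : {group gT}) :
  let C := complement (power_graph G) in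
  let H := induced C (non_isolated C) in
  [/\ is_connected H,
      diameter H <= 3 &
      {in non_isolated C &, forall x y,
        exists2 p : seq gT, is_path C x y p & size p <= 3}].
Proof.
move=> C H.
(* Short paths in [H] give all three claims: they connect [H], bound its distances, and are also
   paths in [C]. *)
have short : {in vertices H &, forall x y,
    exists2 p : seq gT, is_path H x y p & size p <= 3}.
  move=> x y Hx Hy; move: (Hx) (Hy); rewrite !vertices_induced_non_isolated.
  move=> Cx Cy; have [p [Cp pxy szp]] := non_isolated_short_walk Cx Cy.
  rewrite -(eq_path (induced_non_isolated_edge C)) in Cp.
  have [q Hq szq] := is_path_of_walk Hx Cp pxy.
  by exists q => //; apply: leq_trans szp.
split.
- by move=> x y Hx Hy; have [p] := short x y Hx Hy; exists p.
- apply/bigmax_leqP=> x Hx; apply/bigmax_leqP=> y Hy.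
  by have [p /distance_le_size/leq_trans] := short x y Hx Hy; apply.
- move=> x y; rewrite -{1 2}vertices_induced_non_isolated => Hx Hy.
  have [p /and4P[_ Hp Up pxy] szp] := short x y Hx Hy; exists p => //.
  apply/and4P; split=> //; first by case/setIP: Hx.
  by rewrite -(eq_path (induced_non_isolated_edge C)).
Qed.
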